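(* There exist a prime $p$, a finite $p$-group $P$, and a saturated constrained fusion system $\mathcal{F}$ on $P$ such that $|\mathrm{Ind}_{\mathcal{F}}(P)|\neq k(\mathcal{F})$.
   Context: A fusion system $\mathcal{F}$ on a finite $p$-group $P$ is a category whose objects are all subgroups of $P$ and whose morphism sets $\mathrm{Hom}_{\mathcal{F}}(Q,R)$ consist of injective group homomorphisms $Q\to R$ such that: (i) every homomorphism $Q\to R$ induced by conjugation with an element of $P$ lies in $\mathrm{Hom}_{\mathcal{F}}(Q,R)$; (ii) every morphism in $\mathcal{F}$ is the composite of an isomorphism in $\mathcal{F}$ followed by an inclusion. It is saturated if every subgroup of $P$ is $\mathcal{F}$-isomorphic to a subgroup $Q\le P$ such that $\mathrm{Aut}_P(Q)$ (the automorphisms of $Q$ induced by $N_P(Q)$) is a Sylow $p$-subgroup of $\mathrm{Aut}_{\mathcal{F}}(Q)$ and every $\mathcal{F}$-isomorphism $\varphi:R\to Q$ extends to a morphism in $\mathcal{F}$ from $N_\varphi=\{g\in N_P(R): \varphi c_g\varphi^{-1}\in\mathrm{Aut}_P(Q)\}$ to $P$, where $c_g$ denotes conjugation by $g$. For any finite group $G$ with Sylow $p$-subgroup $P$, the category with morphisms given by conjugation in $G$ between subgroups of $P$ is a saturated fusion system on $P$. A saturated fusion system $\mathcal{F}$ on $P$ is constrained if there is a subgroup $Q\unlhd P$ with $C_P(Q)\le Q$ which is normal in $\mathcal{F}$, i.e. every morphism $f:R\to S$ in $\mathcal{F}$ extends to a morphism $RQ\to SQ$ in $\mathcal{F}$ mapping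 $Q$ onto $Q$. Elements $x,y\in P$ are $\mathcal{F}$-conjugate if there is a morphism $f:\langle x\rangle\to P$ in $\mathcal{F}$ with $f(x)=y$; $k(\mathcal{F})$ is the number of $\mathcal{F}$-conjugacy classes of $P$. A complex class function of $P$ is $\mathcal{F}$-invariant if it is constant on the $\mathcal{F}$-conjugacy classes of $P$. Characters are complex characters. A (non-zero) $\mathcal{F}$-invariant character of $P$ is indecomposable if it is not the sum of two non-zero $\mathcal{F}$-invariant characters of $P$. $\mathrm{Ind}_{\mathcal{F}}(P)$ denotes the set of all indecomposable $\mathcal{F}$-invariant characters of $P$. *)

(* Defs.v *)
From mathcomp Require Import classical_sets cardinality.
From mathcomp Require Import all_boot all_order all_algebra.
From mathcomp Require Import all_fingroup all_solvable all_field all_character.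

Set Implicit Arguments.
Unset Strict Implicit.
Unset Printing Implicit Defensive.

Import GroupScope.

Section Homs.

Variable gT : finGroupType.
Implicit Types (Q R : {group gT}) (f : {ffun gT -> gT}).

(* A homomorphism Q -> R is encoded as a finite function on the ambient type  *)
(* with value 1 outside Q, so that equality of homomorphisms is equality of   *)
(* finite functions and composition is composition of functions.              *)
Definition injhoms Q R : {set {ffun gT -> gT}} :=
  [set f : {ffun gT -> gT} |
    [&& morphic Q f, dinjectiveb f Q, f @: Q \subset R
      & [forall x, (x \notin Q) ==> (f x == 1)]]].

Definition homres Q (f : gT -> gT) : {ffun gT -> gT} :=
  [ffun x => if x \in Q then f x else 1].

Definition homcomp (g f : {ffun gT -> gT}) : {ffun gT -> gT} :=
  [ffun x => g (f x)].

End Homs.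

(* Identities and inclusions are morphisms by fs_conj with x = 1.             *)
Record fusion_system (gT : finGroupType) (P : {group gT}) := FusionSystem {
  fHom : {group gT} -> {group gT} -> {set {ffun gT -> gT}};
  fs_obj : forall Q R f, f \in fHom Q R -> Q \subset P /\ R \subset P;
  fs_inj : forall Q R, fHom Q R \subset injhoms Q R;
  fs_comp : forall Q R S f g,
    f \in fHom Q R -> g \in fHom R S -> homcomp g f \in fHom Q S;
  fs_conj : forall (Q R : {group gT}) x, Q \subset P -> R \subset P ->
    x \in P -> Q :^ x \subset R -> homres Q (conjg^~ x) \in fHom Q R;
  fs_factor : forall (Q R : {group gT}) f, f \in fHom Q R ->
    exists (S : {group gT}) (h h' : {ffun gT -> gT}),
      [/\ S \subset R, h \in fHom Q S, h' \in fHom S Q,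
          homcomp h' h = homres Q id /\ homcomp h h' = homres S id
        & f = homcomp (homres S id) h]
}.

Section Saturation.

Variables (gT : finGroupType) (P : {group gT}) (F : fusion_system P).
Implicit Types (Q R S : {group gT}) (f : {ffun gT -> gT}).

Definition fiso Q R f : Prop :=
  f \in fHom F Q R /\
  exists f', [/\ f' \in fHom F R Q, homcomp f' f = homres Q id
               & homcomp f f' = homres R id].

(* Aut Q consists of permutations of gT that are the identity outside Q.      *)
Definition autF Q : {set {perm gT}} :=
  [set a in Aut Q | homres Q a \in fHom F Q Q].

Definition autP Q : {set {perm gT}} := conj_aut Q @* 'N_P(Q).

(* For an isomorphism f : R -> Q, the condition f c_g f^-1 = a is written     *)
(* f c_g = a f on R, where c_g is x |-> x ^ g.                                *)
Definition Nphi R Q f : {set gT} :=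
  [set g in 'N_P(R) | [exists a in autP Q, [forall x in R, f (x ^ g) == a (f x)]]].

Definition extends R f (h : {ffun gT -> gT}) : Prop := {in R, h =1 f}.

(* When f is an isomorphism R -> Q in F, Nphi R Q f is a subgroup; N below is *)
(* that subgroup as an object of the category.                                *)
Definition receptive Q : Prop :=
  forall R f, fiso R Q f ->
  exists (N : {group gT}) (h : {ffun gT -> gT}),
    [/\ N :=: Nphi R Q f, h \in fHom F N P & extends R f h].

Definition saturated (p : nat) : Prop :=
  forall R, R \subset P ->
  exists Q f, [/\ Q \subset P, fiso R Q f, p.-Sylow(autF Q) (autP Q)
                & receptive Q].

(* R <*> Q is the product RQ, since Q is normal in P.                         *)
Definition normal_in_F Q : Prop :=
  forall R S f, f \in fHom F R S ->
  exists h, [/\ h \in fHom F (R <*> Q)%G (S <*> Q)%G, extends R f h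
              & h @: Q = Q].

(* To be combined with saturated F p. *)
Definition constrained : Prop :=
  exists Q, [/\ Q <| P, 'C_P(Q) \subset Q & normal_in_F Q].

Definition fconj : rel gT :=
  fun x y => [exists f in fHom F <[x]>%G P, f x == y].

Definition kF : nat := #|equivalence_partition fconj P|.

Definition invariant (phi : 'CF(P)) : Prop :=
  {in P &, forall x y, fconj x y -> phi x = phi y}.

Definition inv_char (phi : 'CF(P)) : Prop :=
  [/\ phi \is a character, phi != 0%R & invariant phi].

(* algC plays the role of the complex numbers: all character values are      *)
(* algebraic.                                                                 *)
Definition IndF : classical_sets.set 'CF(P) :=
  fun phi => inv_char phi /\
    ~ exists psi1 psi2, [/\ inv_char psi1, inv_char psi2
                          & phi = (psi1 + psi2)%R].

End Saturation.

(* Main.v *)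
From HB Require Import structures.
Require Import Defs.
From mathcomp Require Import classical_sets cardinality.
From mathcomp Require Import all_boot all_order all_algebra.
From mathcomp Require Import all_fingroup all_solvable all_field all_character.
From mathcomp Require Import boolp ring.

(** The example lives on a Sylow 2-subgroup of a regular wreath product.  Let
    H = GL_2(F_17) and let S be the group of monomial matrices in H; since
    16 is a power of 2, S is a Sylow 2-subgroup of H.  Let G be the regular
    wreath product of C_2 by H, V its base group, and P the preimage of S in G.
    The fusion system F of G on P is saturated because P is a Sylow subgroup
    ([group_fusion_saturated]), and constrained because V is a normal
    2-subgroup of G containing its centraliser ([group_fusion_constrained]).

    Every irreducible character of G restricts to an F-invariant character of
    P, so the indecomposable invariant characters span all the restrictions of
    class functions of G, a space of dimension at least k(F)
    ([kF_le_dim]).  Hence if there are exactly k(F) indecomposables, they are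
    linearly independent, and it is enough to exhibit one nontrivial relation
    a + b = c + d between indecomposables ([relation_card_neq]).

    The relation is inflated from S.  Let f be a multiplicative character of
    F_17 with f(-1) = -1, let sgn be the character of S with value 1 on
    diagonal and -1 on antidiagonal matrices, and let theta_n be the character
    of degree 2 with value f^n(a/d) + f^n(d/a) on diag(a, d) and 0 on
    antidiagonal matrices.  Trace and determinant show that the only H-fusion
    in S beyond swapping the two diagonal entries, or identifying antidiagonal
    matrices, is between antidiagonal matrices and matrices diag(a, -a).  At
    diag(a, -a) the value of theta_n is 2 for even n and -2 for odd n, so that
    sgn and theta_2 are not invariant, whereas sgn + theta_n and
    theta_2 + theta_n are invariant for odd n ([eigenvalue_invariant]).  As
    the sum of two irreducible characters is indecomposable as soon as it is
    invariant and one summand is not ([Ind_add_irr]), the relation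
      (sgn + theta_1) + (theta_2 + theta_3)
        = (sgn + theta_3) + (theta_2 + theta_1)
    is the one needed. *)

Set Implicit Arguments.
Unset Strict Implicit.
Unset Printing Implicit Defensive.

Import GroupScope.

(** * The fusion system of a finite group *)

Section GroupFusion.

Variables (gT : finGroupType) (G P : {group gT}).
Hypothesis sPG : P \subset G.
Implicit Types Q R S : {group gT}.

Lemma homresE Q (f : gT -> gT) x : x \in Q -> homres Q f x = f x.
Proof. by move=> Qx; rewrite ffunE Qx. Qed.

Lemma homcomp_conj Q R x y : Q :^ x \subset R ->
  homcomp (homres R (conjg^~ y)) (homres Q (conjg^~ x))
    = homres Q (conjg^~ (x * y)).
Proof.
move=> sQxR; apply/ffunP=> u; rewrite !ffunE.
have [Qu | _] := boolP (u \in Q); last by rewrite group1 conj1g.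
by rewrite (subsetP sQxR) ?memJ_conjg // conjgM.
Qed.

Definition conj_homs Q R : {set {ffun gT -> gT}} :=
  [set f | [&& Q \subset P, R \subset P
             & [exists g in G, (Q :^ g \subset R)
                               && (f == homres Q (conjg^~ g))]]].

Lemma conj_homsP Q R f :
  reflect [/\ Q \subset P, R \subset P
            & exists g, [/\ g \in G, Q :^ g \subset R
                          & f = homres Q (conjg^~ g)]]
          (f \in conj_homs Q R).
Proof.
rewrite inE; apply: (iffP and3P) => -[sQP sRP].
  by case/exists_inP=> g Gg /andP[sQgR /eqP Df]; split=> //; exists g.
case=> g [Gg sQgR Df]; split=> //; apply/exists_inP; exists g => //.
by rewrite sQgR Df /=.
Qed.

Fact conj_homs_obj Q R f : f \in conj_homs Q R -> Q \subset P /\ R \subset P.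
Proof. by case/conj_homsP. Qed.

Fact conj_homs_inj Q R : conj_homs Q R \subset injhoms Q R.
Proof.
apply/subsetP=> f /conj_homsP[_ _ [g [_ sQgR ->]]]; rewrite inE.
apply/and4P; split.
- by apply/morphicP=> x y Qx Qy; rewrite !homresE ?groupM // conjMg.
- apply/dinjectiveP=> x y Qx Qy; rewrite !homresE //; exact: conjg_inj.
- apply/subsetP=> _ /imsetP[x Qx ->].
  by rewrite homresE // (subsetP sQgR) ?memJ_conjg.
- by apply/forallP=> x; apply/implyP=> /negPf Qx; rewrite ffunE Qx.
Qed.

Fact conj_homs_comp Q R S f g :
  f \in conj_homs Q R -> g \in conj_homs R S -> homcomp g f \in conj_homs Q S.
Proof.
case/conj_homsP=> sQP sRP [x [Gx sQR ->]] /conj_homsP[_ sSP [y [Gy sRS ->]]].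
apply/conj_homsP; split=> //; exists (x * y); rewrite groupM //.
split=> //; last exact: homcomp_conj.
by rewrite conjsgM (subset_trans _ sRS) // conjSg.
Qed.

Fact conj_homs_conj Q R x : Q \subset P -> R \subset P ->
  x \in P -> Q :^ x \subset R -> homres Q (conjg^~ x) \in conj_homs Q R.
Proof.
move=> sQP sRP Px sQR; apply/conj_homsP; split=> //.
by exists x; rewrite (subsetP sPG).
Qed.

Lemma homres_conj1 Q : homres Q (conjg^~ 1) = homres Q id.
Proof. by apply/ffunP=> u; rewrite !ffunE conjg1. Qed.

Lemma homcomp_conjV Q R x : Q :^ x \subset R ->
  homcomp (homres R (conjg^~ x^-1)) (homres Q (conjg^~ x)) = homres Q id.
Proof. by move=> sQR; rewrite homcomp_conj // mulgV homres_conj1. Qed.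

Lemma homcomp_conjVr Q x :
  homcomp (homres Q (conjg^~ x)) (homres (Q :^ x)%G (conjg^~ x^-1))
    = homres (Q :^ x)%G id.
Proof. by rewrite homcomp_conj ?mulVg ?homres_conj1 // -conjsgM mulgV conjsg1. Qed.

Fact conj_homs_factor Q R f : f \in conj_homs Q R ->
  exists S (h h' : {ffun gT -> gT}),
    [/\ S \subset R, h \in conj_homs Q S, h' \in conj_homs S Q,
        homcomp h' h = homres Q id /\ homcomp h h' = homres S id
      & f = homcomp (homres S id) h].
Proof.
case/conj_homsP=> sQP sRP [x [Gx sQR ->]].
have sSP : Q :^ x \subset P := subset_trans sQR sRP.
exists (Q :^ x)%G, (homres Q (conjg^~ x)), (homres (Q :^ x)%G (conjg^~ x^-1)).
split=> //.
- by apply/conj_homsP; split=> //; exists x.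
- apply/conj_homsP; split=> //; exists x^-1.
  by rewrite groupV /= -conjsgM mulgV conjsg1.
- by rewrite homcomp_conjV ?homcomp_conjVr.
- by rewrite -homres_conj1 homcomp_conj ?mulg1.
Qed.

Definition group_fusion : fusion_system P :=
  FusionSystem conj_homs_obj conj_homs_inj conj_homs_comp
               conj_homs_conj conj_homs_factor.

Lemma group_fconjP x y :
  reflect [/\ x \in P, y \in P & y \in x ^: G] (fconj group_fusion x y).
Proof.
apply: (iffP exists_inP) => [[f /conj_homsP[sXP _ [g [Gg sXgP ->]]]] |].
  rewrite cycle_subG in sXP; rewrite homresE ?cycle_id // => /eqP Dxg.
  split=> //; last by apply/imsetP; exists g.
  by rewrite -Dxg (subsetP sXgP) // memJ_conjg cycle_id.
case=> Px Py /imsetP[g Gg Dy]; exists (homres <[x]>%G (conjg^~ g)).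
  apply/conj_homsP; rewrite cycle_subG; split=> //; exists g; split=> //.
  by rewrite -cycleJ cycle_subG -Dy.
by rewrite homresE ?cycle_id -?Dy.
Qed.

Lemma group_fisoP Q R f : fiso group_fusion Q R f ->
  [/\ Q \subset P, R \subset P
    & exists g, [/\ g \in G, Q :^ g = R & f = homres Q (conjg^~ g)]].
Proof.
case=> /conj_homsP[sQP sRP [g [Gg sQR ->]]] [f' [f'F _ E]].
split=> //; exists g; split=> //; apply/eqP; rewrite eqEsubset sQR.
apply/subsetP=> y Ry; have:= congr1 (fun h : {ffun _} => h y) E.
have := subsetP (conj_homs_inj R Q) f' f'F; rewrite inE => /and4P[_ _ sf' _].
have Qf'y: f' y \in Q by rewrite (subsetP sf') ?imset_f.
by rewrite [LHS]ffunE !homresE // => <-; rewrite memJ_conjg.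
Qed.

Lemma group_fiso_conj Q g : Q \subset P -> g \in G -> Q :^ g \subset P ->
  fiso group_fusion Q (Q :^ g)%G (homres Q (conjg^~ g)).
Proof.
move=> sQP Gg sQgP; split; first by apply/conj_homsP; split=> //; exists g.
exists (homres (Q :^ g)%G (conjg^~ g^-1)).
split; [| exact: homcomp_conjV | exact: homcomp_conjVr].
apply/conj_homsP; split=> //; exists g^-1; rewrite groupV /=; split=> //.
by rewrite -conjsgM mulgV conjsg1.
Qed.

Lemma group_autF Q : Q \subset P ->
  autF group_fusion Q = conj_aut Q @* 'N_G(Q).
Proof.
move=> sQP; apply/setP=> a; rewrite inE; apply/andP/morphimP.
  case=> Aa /conj_homsP[_ _ [g [Gg sQg Da]]].
  have Ng : g \in 'N(Q) by rewrite inE.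
  exists g => //; first by rewrite inE Gg.
  apply: (eq_Aut Aa) => [|x Qx].
    by rewrite (subsetP (Aut_conj_aut Q 'N(Q))) // mem_morphim.
  rewrite norm_conj_autE //.
  by have := congr1 (fun h : {ffun _} => h x) Da; rewrite /= !homresE.
case=> g Ng /setIP[Gg _] ->; split.
  by rewrite (subsetP (Aut_conj_aut Q 'N(Q))) // mem_morphim.
apply/conj_homsP; split=> //; exists g; split=> //.
  by rewrite (normP Ng).
apply/ffunP=> x; rewrite !ffunE; case: ifP => // Qx.
exact: norm_conj_autE.
Qed.

(** An element x of N_P(R) lies in N_f, f being conjugation by g, exactly when
    x ^ g acts on Q = R ^ g like an element of N_P(Q), that is up to C_G(Q). *)
Lemma Nphi_conj Q R g : Q \subset P -> R \subset P -> g \in G -> Q :=: R :^ g ->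
  Nphi P R Q (homres R (conjg^~ g))
    = 'N_P(R) :&: ('N_P(Q) * 'C_G(Q)) :^ g^-1.
Proof.
move=> sQP sRP Gg DQ; apply/setP=> x; rewrite !inE mem_conjgV.
apply: andb_id2l => /andP[Px sRxR]; have Gx := subsetP sPG x Px.
have nRx : x \in 'N(R) by rewrite inE.
apply/exists_inP/mulsgP => [[_ /morphimP[n nQn NPn ->] /forall_inP E] | ].
  have /setIP[Pn _] := NPn; have Gn := subsetP sPG n Pn.
  exists n (n^-1 * x ^ g) => //; last by rewrite mulKVg.
  apply/setIP; split; first by rewrite groupM ?groupV // groupJ.
  apply/centP=> q Qq; apply/commute_sym/commgP/conjg_fixP.
  have Qq' : q ^ n^-1 \in Q by rewrite memJ_norm ?groupV.
  have Ry : (q ^ n^-1) ^ g^-1 \in R by rewrite -mem_conjg -DQ.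
  have := eqP (E _ Ry); rewrite !homresE ?(memJ_norm _ nRx) // conjgKV.
  by rewrite norm_conj_autE // [LHS]conjJg !conjgKV => Eq; rewrite conjgM.
case=> n c NPn /setIP[_ /centP cQ] Dx; have /setIP[_ nQn] := NPn.
exists (conj_aut Q n); first exact: mem_morphim.
apply/forall_inP=> y Ry; have Qy : y ^ g \in Q by rewrite DQ memJ_conjg.
rewrite !homresE ?(memJ_norm _ nRx) // norm_conj_autE // [X in X == _]conjJg Dx conjgM.
by apply/eqP/conjg_fixP/commgP/commute_sym/cQ; rewrite memJ_norm.
Qed.

(** N_P(Q) is a Sylow subgroup of N_P(Q) C_G(Q), which contains the conjugate of
    N_f by g; so an element c of C_G(Q) moves that conjugate into N_P(Q), and
    conjugation by g c^-1 extends f because c centralises Q. *)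
Lemma fully_normalized_receptive (p : nat) Q : p.-group P -> Q \subset P ->
  p.-Sylow('N_G(Q)) 'N_P(Q) -> receptive group_fusion Q.
Proof.
move=> pP sQP sylN R f /group_fisoP[sRP _ [g [Gg DQ ->]]].
rewrite (Nphi_conj sQP sRP Gg (esym DQ)).
have nCN : 'N_P(Q) \subset 'N('C_G(Q)).
  rewrite normsI ?(subset_trans (subsetIl _ _) (subset_trans sPG (normG G))) //.
  by rewrite (subset_trans (subsetIr _ _)) ?norms_cent.
rewrite -norm_joinEl //; set K := ('N_P(Q) <*> 'C_G(Q))%G.
have sNK : 'N_P(Q) \subset K := joing_subl _ _.
have sylK : p.-Sylow(K) 'N_P(Q).
  apply: pHall_subl sNK _ sylN.
  by rewrite join_subG setSI //= setIS // cent_sub.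
pose N := ('N_P(R) :&: K :^ g^-1)%G.
have sNP : N \subset P := subset_trans (subsetIl _ _) (subsetIl _ _).
have sRN : R \subset N.
  rewrite !subsetI sRP normG -sub_conjg DQ.
  by rewrite (subset_trans _ sNK) // subsetI sQP normG.
have [k Kk sNk] : exists2 k, k \in K & (N :^ g) :^ k \subset 'N_P(Q).
  apply: (Sylow_Jsub sylK); first by rewrite sub_conjg subsetIr.
  by rewrite pgroupJ (pgroupS sNP).
have := groupVr Kk; rewrite /= {1}norm_joinEl // => /mulsgP[n c Nn Cc Dk].
have {}sNk : N :^ (g * c^-1) \subset 'N_P(Q).
  have -> : c^-1 = k * n by rewrite -[k]invgK Dk invMg mulgKV.
  by rewrite !conjsgM sub_conjg (conjGid (groupVr Nn)).
exists N, (homres N (conjg^~ (g * c^-1))); split=> //.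
  apply/conj_homsP; split=> //.
  have /setIP[Gc _] := Cc.
  exists (g * c^-1); rewrite groupM ?groupV //; split=> //.
  exact: subset_trans sNk (subsetIl _ _).
move=> x Rx; rewrite !homresE ?(subsetP sRN) // conjgM.
have /setIP[_ /centP cQ] := Cc.
apply/conjg_fixP/commgP; apply: commuteV; apply/commute_sym/cQ.
by rewrite -DQ memJ_conjg.
Qed.

(** A Sylow subgroup U of N_G(R) contains R, and a conjugate U ^ g lies in P;
    then R ^ g is fully normalised, its normaliser in P being U ^ g. *)
Lemma group_fusion_saturated p : p.-Sylow(G) P -> saturated group_fusion p.
Proof.
move=> sylP R sRP; have pP := pHall_pgroup sylP.
have sRG := subset_trans sRP sPG.
have [U sylU] := Sylow_exists p 'N_G(R).
have sRU : R \subset U.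
  apply: (normal_sub_max_pgroup (Hall_max sylU)); first exact: pgroupS pP.
  by rewrite /normal subsetI sRG normG subsetIr.
have sUG := subset_trans (pHall_sub sylU) (subsetIl _ _).
have [g Gg sUgP] := Sylow_Jsub sylP sUG (pHall_pgroup sylU).
have sRgP : R :^ g \subset P by rewrite (subset_trans _ sUgP) // conjSg.
have sylN : p.-Sylow('N_G(R :^ g)) 'N_P(R :^ g).
  have sylUg : p.-Sylow('N_G(R :^ g)) (U :^ g).
    by rewrite -{1}(conjGid Gg) normJ -conjIg pHallJ2.
  rewrite (sub_pHall sylUg (pgroupS (subsetIl _ _) pP)) ?setSI //.
  by rewrite subsetI sUgP (subset_trans (pHall_sub sylUg)) ?subsetIr.
exists (R :^ g)%G, (homres R (conjg^~ g)); split=> //.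
- exact: group_fiso_conj.
- rewrite group_autF // /autP; apply: morphim_pSylow sylN.
  exact: subsetIr.
- exact: fully_normalized_receptive sylN.
Qed.

(** Conjugation by an element of G extends to products with V since V is normal
    in G. *)
Lemma group_fusion_constrained (V : {group gT}) :
  V <| G -> V \subset P -> 'C_P(V) \subset V -> constrained group_fusion.
Proof.
move=> nVG sVP cVP; exists V; split=> //; first exact: normalS nVG.
move=> R S f /conj_homsP[sRP sSP [g [Gg sRgS ->]]].
have nVg := subsetP (normal_norm nVG) g Gg.
exists (homres (R <*> V)%G (conjg^~ g)); split.
- apply/conj_homsP; rewrite !join_subG sRP sSP sVP; split=> //; exists g.
  split=> //; rewrite /= conjYg (normP nVg) join_subG joing_subr.
  by rewrite (subset_trans sRgS) ?joing_subl.
- by move=> x Rx; rewrite !homresE // (subsetP (joing_subl _ _)).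
- apply: etrans (normP nVg); apply: eq_in_imset => x Vx.
  by rewrite homresE // (subsetP (joing_subr _ _)).
Qed.

End GroupFusion.

Import GRing.Theory Num.Theory.
Local Open Scope ring_scope.

(** * Indecomposable invariant characters *)

Section Indecomposable.

Variables (gT : finGroupType) (P : {group gT}) (F : fusion_system P).
Implicit Types phi psi chi : 'CF(P).

Lemma inv_char_split phi : inv_char F phi -> ~ IndF F phi ->
  exists psi1 psi2, [/\ inv_char F psi1, inv_char F psi2 & phi = (psi1 + psi2)%R].
Proof.
by move=> invphi nInd; apply: contrapT => nsplit; apply: nInd; split.
Qed.

(** Every invariant character is a sum of indecomposable ones, by induction on
    the degree. *)
Lemma inv_char_sub_Ind (U : {vspace 'CF(P)}) :
  (forall phi, IndF F phi -> phi \in U) ->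
  forall phi, inv_char F phi -> phi \in U.
Proof.
move=> sIU phi; have [n] := ubnP (Num.truncn (phi 1%g)).
elim: n phi => // n IHn phi le_phi_n invphi.
have [/sIU // | /(inv_char_split invphi)[psi1 [psi2 [inv1 inv2 Dphi]]]] :=
  pselect (IndF F phi).
have natC psi : inv_char F psi -> psi 1%g = (Num.truncn (psi 1%g))%:R.
  by case=> Npsi _ _; rewrite truncnK // Cnat_char1.
have gt0 psi : inv_char F psi -> (0 < Num.truncn (psi 1%g))%N.
  move=> invpsi; have [Npsi nz _] := invpsi.
  by rewrite -(ltr_nat algC) -natC // char1_gt0.
have D1 : Num.truncn (phi 1%g) = (Num.truncn (psi1 1%g) + Num.truncn (psi2 1%g))%N.
  apply/eqP; rewrite -(eqr_nat algC) natrD -!natC // Dphi cfunE //.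
move: le_phi_n; rewrite D1 ltnS => le_n.
rewrite Dphi memvD ?IHn ?(leq_trans _ le_n) //.
  by rewrite -addn1 leq_add2l gt0.
by rewrite -add1n leq_add2r gt0.
Qed.

Lemma irr_not_add (j : Iirr P) (psi1 psi2 : 'CF(P)) :
  psi1 \is a character -> psi2 \is a character -> psi2 != 0 ->
  'chi_j = psi1 + psi2 -> psi1 = 0.
Proof.
move=> N1 N2 nz2 Dj; apply/eqP/contraT=> /neq0_has_constt[k k1].
have [psi Npsi D1] := constt_charP _ N1 k1.
have : k \in irr_constt 'chi_j.
  apply/constt_charP; first exact: irr_char.
  by exists (psi + psi2); rewrite ?rpredD // Dj D1 addrA.
rewrite constt_irr inE => /eqP Ekj; move: Dj; rewrite D1 Ekj -addrA.
rewrite -[LHS]addr0 => /addrI/esym/(congr1 (fun phi : 'CF(P) => phi 1%g))/eqP.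
by rewrite !cfunE paddr_eq0 ?char1_ge0 // !char1_eq0 // (negPf nz2) andbF.
Qed.

Lemma irr_add_sub (i j : Iirr P) (psi1 psi2 : 'CF(P)) :
  psi1 \is a character -> psi1 != 0 -> psi2 \is a character -> psi2 != 0 ->
  'chi_i + 'chi_j = psi1 + psi2 -> psi1 = 'chi_i \/ psi2 = 'chi_i.
Proof.
wlog i1 : psi1 psi2 / i \in irr_constt psi1.
  move=> IH N1 nz1 N2 nz2 E.
  have : (i \in irr_constt psi1) || (i \in irr_constt psi2).
    apply: contraT; rewrite !irr_consttE negb_or !negbK => /andP[/eqP E1 /eqP E2].
    have /eqP := congr1 (fun phi => '[phi, 'chi_i]) E.
    by rewrite !cfdotDl E1 E2 !cfdot_irr eqxx addr0 paddr_eq0 ?ler0n ?oner_eq0.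
  case/orP=> [/IH | /(IH psi2 psi1) {}IH]; first exact.
  by case: (IH N2 nz2 N1 nz1); [rewrite E addrC | right | left].
move=> N1 nz1 N2 nz2 E; left.
have [psi Npsi D1] := constt_charP _ N1 i1.
move: E; rewrite D1 -addrA => /addrI/(irr_not_add Npsi N2 nz2) ->.
by rewrite addr0.
Qed.

(** The only way to split a sum of two irreducible characters is into these two
    characters, so one of the parts would be 'chi_i. *)
Lemma Ind_add_irr (i j : Iirr P) :
  ~ Defs.invariant F 'chi_i -> Defs.invariant F ('chi_i + 'chi_j)%R ->
  IndF F ('chi_i + 'chi_j)%R.
Proof.
move=> ninv inv; split.
  split=> //; first by rewrite rpredD ?irr_char.
  rewrite -char1_eq0 ?rpredD ?irr_char // cfunE lt0r_neq0 //.
  by rewrite addr_gt0 ?irr1_gt0.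
case=> psi1 [psi2 [[N1 nz1 inv1] [N2 nz2 inv2]]].
by case/(irr_add_sub N1 nz1 N2 nz2) => E; apply: ninv; rewrite -E.
Qed.

End Indecomposable.

(** * Indecomposable characters and the number of fusion classes *)

Section Count.

Variables (gT : finGroupType) (G P : {group gT}) (sPG : P \subset G).
Let F := group_fusion sPG.

Lemma Res_irr_inv_char (i : Iirr G) : inv_char F ('Res[P] 'chi_i).
Proof.
split; first by rewrite cfRes_char ?irr_char.
  by rewrite -char1_eq0 ?cfRes_char ?irr_char // cfRes1 irr1_neq0.
move=> x y Px Py /group_fconjP[_ _ /imsetP[g Gg Dy]].
by rewrite !cfResE // Dy cfunJ.
Qed.

Lemma fconj_equiv : {in P & &, equivalence_rel (fconj F)}.
Proof.
move=> x y z Px Py Pz; split; first by apply/group_fconjP; rewrite class_refl.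
move=> /group_fconjP[_ _ /class_eqP Eyx].
apply/group_fconjP/group_fconjP; rewrite ?Eyx => -[_ _ xz]; split=> //.
Qed.

Lemma fconj_classE (x y : gT) : x \in P -> y \in P ->
  fconj F x y = (y \in x ^: G).
Proof. by move=> Px Py; apply/group_fconjP/idP=> [[] | ]. Qed.

(** The indicators of the classes of G that meet P are combinations of
    irreducible characters of G; their restrictions to P therefore lie in U, and
    they are independent because a class of G meets P in one fusion class. *)
Lemma kF_le_dim (U : {vspace 'CF(P)}) :
  (forall phi, inv_char F phi -> phi \in U) -> (kF F <= \dim U)%N.
Proof.
move=> sIU; set C := equivalence_partition (fconj F) P.
pose rep (i : 'I_#|C|) := repr (enum_val i).
have partC : partition C P := equivalence_partitionP fconj_equiv.
have Crep i : rep i \in enum_val i.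
  have [B0 | [x Bx]] := set_0Vmem (enum_val i); last exact: mem_repr Bx.
  by have /and3P[_ _ /negP[]] := partC; rewrite -B0 enum_valP.
have Prep i : rep i \in P.
  rewrite -(cover_partition partC); apply/bigcupP.
  by exists (enum_val i); rewrite ?enum_valP.
have rep_class i j : rep j \in rep i ^: G -> i = j.
  rewrite -fconj_classE // => Fij; apply: enum_val_inj.
  have trivC := partition_trivIset partC.
  rewrite -(def_pblock trivC (enum_valP i) (Crep i)).
  rewrite -(def_pblock trivC (enum_valP j) (Crep j)).
  apply/esym; apply: same_pblock => //.
  by rewrite (pblock_equivalence_partition fconj_equiv).
pose b := [tuple 'Res[P] ('1_(rep i ^: G) : 'CF(G)) | i < #|C|].
have bE i j : tnth b i (rep j) = (i == j)%:R.
  rewrite tnth_mktuple cfResE // cfuniE ?class_normal ?(subsetP sPG) //.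
  by congr ((nat_of_bool _)%:R); apply/idP/eqP=> [/rep_class // | ->]; rewrite class_refl.
have sbU : (<<b>> <= U)%VS.
  apply/span_subvP=> _ /mapP[i _ ->].
  rewrite (cfun_sum_cfdot '1_(rep i ^: G)) linear_sum rpred_sum // => k _.
  by rewrite linearZ rpredZ // sIU //; apply: Res_irr_inv_char.
(* b stays folded under simplification from here on *)
clearbody b; have freeb : free b.
  apply/freeP=> k sum0 i; move: sum0 => /(congr1 (fun phi : 'CF(P) => phi (rep i))).
  rewrite sum_cfunE cfunE (bigD1 i) //= big1 => [|j neq_ji].
    by rewrite !cfunE -(tnth_nth 0) bE eqxx mulr1 addr0.
  by rewrite !cfunE -(tnth_nth 0) bE (negPf neq_ji) mulr0.
move: (dimvS sbU); rewrite (eqP freeb) size_tuple; apply: leq_trans.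
by rewrite leqnn.
Qed.

(** If there were only k(F) indecomposables, they would be free, as they span a
    space of dimension at least k(F). *)
Lemma relation_card_neq (a b c d : 'CF(P)) :
  IndF F a -> IndF F b -> IndF F c -> IndF F d ->
  (a + b = c + d)%R -> a != c -> a != d ->
  (IndF F #!= (`I_(kF F))%classic)%card.
Proof.
move=> Ia Ib Ic Id Eabcd nac nad; apply/negP.
case/card_set_bijP=> f [f_lt f_inj f_surj].
have [e eP] : exists e : 'I_(kF F) -> 'CF(P), forall i, IndF F (e i) /\ f (e i) = i.
  apply: (fin_all_exists
    (P := fun (i : 'I_(kF F)) phi => IndF F phi /\ f phi = i)) => i.
  by have [phi Iphi Ephi] := f_surj i (ltn_ord i); exists phi.
pose es := [tuple e i | i < kF F].
have esP phi : IndF F phi -> exists i : 'I_(kF F), phi = es`_i :> 'CF(P).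
  move=> Iphi; exists (Ordinal (f_lt phi Iphi)); rewrite -tnth_nth tnth_mktuple.
  have [Ie Ee] := eP (Ordinal (f_lt phi Iphi)).
  apply: f_inj; [exact: mem_set | exact: mem_set | by rewrite Ee].
have freee : free es.
  rewrite /free eqn_leq dim_span size_tuple.
  apply: kF_le_dim; apply: inv_char_sub_Ind => phi /esP[i ->].
  by rewrite memv_span ?mem_nth ?size_tuple.
clearbody es.
have [[i Da] [j Db]] := (esP a Ia, esP b Ib).
have [[k Dc] [l Dd]] := (esP c Ic, esP d Id).
have := congr1 (coord es i) Eabcd; move: nac nad.
rewrite Da Db Dc Dd !raddfD /= !coord_free //= eqxx.
have [-> | _] := eqVneq i k; first by rewrite eqxx.
have [-> | _ _ _ /eqP] := eqVneq i l; first by rewrite eqxx.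
by rewrite addr0 paddr_eq0 ?ler0n // oner_eq0.
Qed.

End Count.

(** * The regular wreath product of C_2 by a finite group *)

Local Open Scope group_scope.

Section Wreath.

Variable hT : finGroupType.

(** The base group is written additively as boolean functions, on which the group
    hT acts by right translation. *)
Definition wreath2 : Type := ({ffun hT -> bool} * hT)%type.

HB.instance Definition _ := Finite.on wreath2.

Definition wmul (x y : wreath2) : wreath2 :=
  ([ffun t => x.1 (t * y.2^-1) (+) y.1 t], x.2 * y.2).
Definition wone : wreath2 := ([ffun=> false], 1).
Definition winv (x : wreath2) : wreath2 := ([ffun t => x.1 (t * x.2)], x.2^-1).

Fact wmulA : associative wmul.
Proof.
move=> x y z; congr (_, _); last exact: mulgA.
by apply/ffunP=> t; rewrite !ffunE /= invMg mulgA addbA.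
Qed.

Fact wmul1 : left_id wone wmul.
Proof.
by case=> f h; congr (_, _); rewrite /= ?mul1g //; apply/ffunP=> t; rewrite !ffunE.
Qed.

Fact wmulV : left_inverse wone winv wmul.
Proof.
move=> x; congr (_, _); last exact: mulVg.
by apply/ffunP=> t; rewrite !ffunE /= mulgKV addbb.
Qed.

HB.instance Definition _ := Finite_isGroup.Build wreath2 wmulA wmul1 wmulV.

Definition wproj (x : wreath2) : hT := x.2.

Lemma wproj1 : wproj 1 = 1. Proof. by []. Qed.

Lemma wprojM x y : wproj (x * y) = wproj x * wproj y. Proof. by []. Qed.

Fact wproj_is_morphism : {in [set: wreath2] &, {morph wproj : x y / x * y}}.
Proof. by []. Qed.

Canonical wproj_morphism := Morphism wproj_is_morphism.

Definition wlift (h : hT) : wreath2 := ([ffun=> false], h).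

Lemma wliftK : cancel wlift wproj. Proof. by []. Qed.

Lemma wliftM g h : wlift (g * h) = wlift g * wlift h.
Proof. by congr (_, _); apply/ffunP=> t; rewrite !ffunE. Qed.

Lemma wliftJ h g : wlift (h ^ g) = wlift h ^ wlift g.
Proof. by apply: (mulgI (wlift g)); rewrite -wliftM -!conjgC wliftM. Qed.

Lemma wproj_surj : wproj @* [set: wreath2] = [set: hT].
Proof.
apply/setP=> h; rewrite inE; apply/morphimP.
by exists (wlift h); rewrite ?inE.
Qed.

Lemma wbase_pgroup : 2.-group ('ker wproj).
Proof.
have -> : 'ker wproj = [set ((f, 1) : wreath2) | f : {ffun hT -> bool}].
  apply/setP=> x; apply/kerP/imsetP; rewrite ?inE //.
    by move=> Dx; exists x.1; rewrite // -Dx; case: x {Dx}.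
  by case=> f _ ->.
rewrite /pgroup card_imset => [|f g [] //].
by rewrite card_ffun card_bool pnatX.
Qed.

(** Commuting with the indicator function of 1 forces the component in hT to be
    trivial, the translation action being regular. *)
Lemma wbase_self_centralising : 'C('ker wproj) \subset 'ker wproj.
Proof.
apply/subsetP=> x /centP cx; apply/kerP; rewrite ?inE //.
pose d : wreath2 := ([ffun t => t == 1], 1).
have /cx/(congr1 (fun y : wreath2 => y.1 x.2)) : d \in 'ker wproj.
  by apply/kerP; rewrite ?inE.
rewrite /= !ffunE /= mulgV eqxx invg1 mulg1.
by case: eqP => //; case: (x.1 _).
Qed.

Variable S : {group hT}.
Hypothesis sylS : 2.-Sylow([set: hT]) S.

(** The kernel of the projection onto hT is a 2-group. *)
Lemma wreath_Sylow : 2.-Sylow([set: wreath2]) (wproj @*^-1 S).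
Proof.
rewrite -(@pmorphim_pHall _ _ _ wproj_morphism) ?subsetT //.
  by rewrite morphpreK ?wproj_surj ?subsetT.
rewrite setIT /psubgroup wbase_pgroup andbT.
by apply: morphpreS; rewrite sub1G.
Qed.

Definition wfusion := group_fusion (subsetT (wproj @*^-1 S)).

Lemma wfusion_saturated : saturated wfusion 2.
Proof. exact: group_fusion_saturated wreath_Sylow. Qed.

Lemma wfusion_constrained : constrained wfusion.
Proof.
apply: (@group_fusion_constrained _ _ _ _ ('ker wproj_morphism)%G).
- exact: ker_normal.
- exact: ker_sub_pre.
- exact: subset_trans (subsetIr _ _) wbase_self_centralising.
Qed.

End Wreath.
Arguments wproj {hT} x.
Arguments wlift {hT} h.

Local Open Scope ring_scope.

(** * An odd multiplicative character of a finite field *)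

Section OddCharacter.

Variable K : finFieldType.
Hypothesis charK : (-1 : K) != 1.

(** Some irreducible character of the group of units does not have -1 in its
    kernel; it is extended by 0 to the whole field. *)
Lemma odd_field_char : exists f : K -> algC,
  [/\ f 0 = 0, f 1 = 1, {morph f : x y / x * y} & f (-1) = -1].
Proof.
pose A := [set: {unit K}].
have cAA : abelian A by apply/centsP=> u _ v _; apply: val_inj; apply: mulrC.
pose m1 : {unit K} := FinRing.unit K (unitrN1 K).
have m1K : (m1 * m1)%g = 1%g by apply: val_inj; rewrite /= mulrNN mulr1.
have [i ni] : exists i : Iirr A, 'chi_i m1 != 1.
  apply/existsP; apply: contraR charK; rewrite negb_exists => /forallP all1.
  have : m1 \in \bigcap_i cfker 'chi[A]_i.
    apply/bigcapP=> i _; have lin_i := char_abelianP _ cAA i.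
    rewrite cfkerEirr inE (eqP (negbNE (all1 i))) eq_sym.
    by rewrite -(lin_char1 lin_i).
  by rewrite TI_cfker_irr => /set1P/(congr1 val)/= ->.
have lin_i := char_abelianP _ cAA i.
pose f x := oapp (fun u : {unit K} => 'chi_i u) 0 (insub x).
have fE u : f (val u) = 'chi_i u by rewrite /f valK.
have f0 : f 0 = 0 by rewrite /f insubF // unitr0.
have fnz x : x != 0 -> exists2 u : {unit K}, x = val u & f x = 'chi_i u.
  by rewrite -unitfE => Ux; exists (FinRing.unit K Ux) => //; rewrite -fE.
exists f; split=> //.
- by have := fE 1%g; rewrite lin_char1.
- move=> x y; have [-> | /fnz[u -> _]] := eqVneq x 0; first by rewrite mul0r f0 mul0r.
  have [-> | /fnz[v -> _]] := eqVneq y 0; first by rewrite mulr0 f0 mulr0.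
  by rewrite -[val u * val v]/(val (u * v)%g) !fE lin_charM ?inE.
- have : 'chi_i m1 ^+ 2 == 1 by rewrite expr2 -lin_charM ?inE // m1K lin_char1.
  by rewrite sqrf_eq1 (negPf ni) /= -fE => /eqP.
Qed.

End OddCharacter.

(** * Monomial matrices in GL_2 *)

Lemma sum2E (R : nmodType) (F : 'I_2 -> R) : \sum_i F i = F 0 + F 1.
Proof.
rewrite big_ord_recl big_ord1; congr (_ + F _).
by apply: val_inj.
Qed.

Lemma ord2P (k : 'I_2) : k = 0 \/ k = 1.
Proof. by case: k => [[|[|//]] lt_k]; [left | right]; apply: val_inj. Qed.

Definition mx2 (R : Type) (a b c d : R) : 'M[R]_2 :=
  \matrix_(i, j) if i == 0 then (if j == 0 then a else b)
                 else (if j == 0 then c else d).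

Lemma mx2M (R : pzRingType) (a b c d a' b' c' d' : R) :
  mx2 a b c d *m mx2 a' b' c' d'
    = mx2 (a * a' + b * c') (a * b' + b * d') (c * a' + d * c') (c * b' + d * d').
Proof.
apply/matrixP=> i j; rewrite !mxE sum2E !mxE /=.
by case: (ord2P i) => ->; case: (ord2P j) => ->.
Qed.

Section Matrices2.

Variable K : finFieldType.
Implicit Types x y g : {'GL_2[K]}.

Definition m00 x : K := GLval x 0 0.
Definition m01 x : K := GLval x 0 1.
Definition m10 x : K := GLval x 1 0.
Definition m11 x : K := GLval x 1 1.

Lemma det2 (A : 'M[K]_2) : \det A = A 0 0 * A 1 1 - A 0 1 * A 1 0.
Proof.
rewrite (expand_det_row _ 0) sum2E /cofactor !det_mx11 !mxE /=.
have -> : lift 0 0 = 1 :> 'I_2 by apply: val_inj.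
have -> : lift 1 0 = 0 :> 'I_2 by apply: val_inj.
by rewrite expr0 mul1r expr1 mulN1r mulrN.
Qed.

Lemma m00M x y : m00 (x * y)%g = m00 x * m00 y + m01 x * m10 y.
Proof. by rewrite /m00 GL_MxE mxE sum2E. Qed.
Lemma m01M x y : m01 (x * y)%g = m00 x * m01 y + m01 x * m11 y.
Proof. by rewrite /m01 GL_MxE mxE sum2E. Qed.
Lemma m10M x y : m10 (x * y)%g = m10 x * m00 y + m11 x * m10 y.
Proof. by rewrite /m10 GL_MxE mxE sum2E. Qed.
Lemma m11M x y : m11 (x * y)%g = m10 x * m01 y + m11 x * m11 y.
Proof. by rewrite /m11 GL_MxE mxE sum2E. Qed.
Definition mentM := (m00M, m01M, m10M, m11M).

Lemma ment1 : ((m00 1%g = 1) * (m01 1%g = 0) * (m10 1%g = 0) * (m11 1%g = 1))%type.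
Proof. by rewrite /m00 /m01 /m10 /m11 !GL_1E !mxE. Qed.

Lemma ment_inj x y :
  m00 x = m00 y -> m01 x = m01 y -> m10 x = m10 y -> m11 x = m11 y -> x = y.
Proof.
move=> E00 E01 E10 E11; apply: val_inj; apply/matrixP=> i j.
by case: (ord2P i) => ->; case: (ord2P j) => ->.
Qed.

Lemma GL2_det x : \det (GLval x) = m00 x * m11 x - m01 x * m10 x.
Proof. by rewrite det2. Qed.

Lemma GL2_trace x : \tr (GLval x) = m00 x + m11 x.
Proof. by rewrite /mxtrace sum2E. Qed.

Lemma GL2_similar x y g : GLval g *m GLval y = GLval x *m GLval g ->
  m00 y + m11 y = m00 x + m11 x
  /\ m00 y * m11 y - m01 y * m10 y = m00 x * m11 x - m01 x * m10 x.
Proof.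
move=> E; rewrite -!GL2_trace -!GL2_det; split; last first.
  by apply: (mulfI (GL_det g)); rewrite -det_mulmx E det_mulmx mulrC.
rewrite -[GLval y](mulKmx (GL_unitmx g)) E mxtrace_mulC -mulmxA mulmxV ?mulmx1 //.
exact: GL_unitmx.
Qed.

Definition gl2 a b c d : {'GL_2[K]} := insubd (1%g : {'GL_2[K]}) (mx2 a b c d).

Lemma gl2K a b c d : a * d - b * c != 0 ->
  (m00 (gl2 a b c d) = a) * (m01 (gl2 a b c d) = b)
  * (m10 (gl2 a b c d) = c) * (m11 (gl2 a b c d) = d).
Proof.
move=> nz; suff E : GLval (gl2 a b c d) = mx2 a b c d.
  by rewrite /m00 /m01 /m10 /m11 !E !mxE.
apply: insubdK; rewrite -topredE /= [_ \is a _]unitmxE unitfE.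
by rewrite det2 !mxE.
Qed.

Definition diag_gl2 x := (m01 x == 0) && (m10 x == 0).
Definition antidiag_gl2 x := (m00 x == 0) && (m11 x == 0).
Definition monomials := [set x | diag_gl2 x || antidiag_gl2 x].

Lemma GL2_nz x : m00 x * m11 x - m01 x * m10 x != 0.
Proof. by rewrite -GL2_det GL_det. Qed.

Variant monomial_spec x : Prop :=
| Diagonal of m01 x = 0 & m10 x = 0 & m00 x != 0 & m11 x != 0
| Antidiagonal of m00 x = 0 & m11 x = 0 & m01 x != 0 & m10 x != 0.

Lemma monomialP x : x \in monomials -> monomial_spec x.
Proof.
rewrite inE => /orP[/andP[/eqP E1 /eqP E2] | /andP[/eqP E1 /eqP E2]];
  move: (GL2_nz x); rewrite E1 E2.
  by rewrite mul0r subr0 mulf_eq0 negb_or => /andP[]; left.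
by rewrite mul0r sub0r oppr_eq0 mulf_eq0 negb_or => /andP[]; right.
Qed.

Fact monomials_group_set : group_set monomials.
Proof.
apply/group_setP; split=> [|x y]; first by rewrite inE /diag_gl2 !ment1 eqxx.
case/monomialP=> x1 x2 _ _; case/monomialP=> y1 y2 _ _; rewrite inE;
  apply/orP; rewrite /diag_gl2 /antidiag_gl2 !mentM x1 x2 y1 y2;
  by rewrite !(mulr0, mul0r, addr0, eqxx); [left + right].
Qed.
Canonical monomials_group := Group monomials_group_set.

Lemma card_monomials : #|monomials| = (2 * #|K|.-1 ^ 2)%N.
Proof.
pose h (t : bool * ({unit K} * {unit K})) :=
  let: (s, (u, v)) := t in
  if s then gl2 (val u) 0 0 (val v) else gl2 0 (val u) (val v) 0.
have nz (u : {unit K}) : val u != 0 by rewrite -unitfE (valP u).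
have d1 (u v : {unit K}) : val u * val v - 0 * 0 != 0 by rewrite mul0r subr0 mulf_neq0.
have d2 (u v : {unit K}) : 0 * 0 - val u * val v != 0.
  by rewrite mul0r sub0r oppr_eq0 mulf_neq0.
have -> : monomials = h @: setT.
  apply/setP=> x; apply/idP/imsetP.
    case/monomialP=> x1 x2 nz1 nz2.
      have U1 : m00 x \is a GRing.unit by rewrite unitfE.
      have U2 : m11 x \is a GRing.unit by rewrite unitfE.
      exists (true, (FinRing.unit K U1, FinRing.unit K U2)); rewrite ?inE //.
      by apply: ment_inj; rewrite /= !gl2K //= ?mul0r ?subr0 ?mulf_neq0.
    have U1 : m01 x \is a GRing.unit by rewrite unitfE.
    have U2 : m10 x \is a GRing.unit by rewrite unitfE.
    exists (false, (FinRing.unit K U1, FinRing.unit K U2)); rewrite ?inE //.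
    by apply: ment_inj; rewrite /= !gl2K //= ?mul0r ?sub0r ?oppr_eq0 ?mulf_neq0.
  case=> -[[] [u v]] _ ->; rewrite inE /diag_gl2 /antidiag_gl2 /h.
    by rewrite !(gl2K (d1 u v)) eqxx.
  by rewrite !(gl2K (d2 u v)) eqxx orbT.
rewrite card_imset.
  by rewrite cardsT !card_prod card_bool -cardsT card_finField_unit mulnn.
move=> [s [u v]] [s' [u' v']] E.
have := (congr1 m00 E, congr1 m01 E, congr1 m10 E, congr1 m11 E); rewrite /h.
case: s {E}; case: s'; rewrite !(gl2K (d1 _ _), gl2K (d2 _ _)).
- by case=> -[[/val_inj-> _] _] /val_inj->.
- by case=> -[[/eqP E _] _] _; case/negP: (nz u).
- by case=> -[[/esym/eqP E _] _] _; case/negP: (nz u').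
- by case=> -[[_ /val_inj->] /val_inj->] _.
Qed.

End Matrices2.

(** * Irreducible characters of degree 2 *)

Section DegreeTwo.

Variables (gT : finGroupType) (P : {group gT}).

Lemma lin_char_comm (chi : 'CF(P)) x y :
  chi \is a linear_char -> x \in P -> y \in P -> chi [~ x, y]%g = 1.
Proof.
move=> lin_chi Px Py; rewrite commgEl lin_charM ?groupV ?groupJ //.
by rewrite cfunJ // -lin_charM ?groupV // mulVg lin_char1.
Qed.

(** A reducible character of degree 2 is a sum of two linear ones, which take the
    value 1 at commutators. *)
Lemma degree2_irr (chi : 'CF(P)) x y :
  chi \is a character -> chi 1%g = 2%:R -> x \in P -> y \in P ->
  chi [~ x, y]%g != 2%:R -> chi \in irr P.
Proof.
move=> Nchi chi1 Px Py; apply: contraR => nirr.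
have nz : chi != 0 by rewrite -char1_eq0 // chi1 pnatr_eq0.
have [i /constt_charP-/(_ Nchi)[psi Npsi Dchi]] := neq0_has_constt nz.
have nzpsi : psi != 0.
  by apply: contraNneq nirr => psi0; rewrite Dchi psi0 addr0 mem_irr.
have /natrP[m Dm] := Cnat_irr1 i; have /natrP[n Dn] := Cnat_char1 Npsi.
have m_gt0 : (0 < m)%N by rewrite -(ltr_nat algC) -Dm irr1_gt0.
have n_gt0 : (0 < n)%N by rewrite -(ltr_nat algC) -Dn char1_gt0.
have /eqP : (m + n)%:R = 2%:R :> algC by rewrite natrD -Dm -Dn -chi1 Dchi cfunE.
rewrite eqr_nat => /eqP mn2.
have m1 : m = 1%N.
  case: m m_gt0 n_gt0 mn2 {Dm} => [|[|m]] //.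
  by case: n {Dn} => // n; rewrite addnS.
have n1 : n = 1%N by move: mn2; rewrite m1 => -[].
rewrite Dchi cfunE !lin_char_comm //; first by rewrite qualifE /= Npsi Dn n1 /=.
by rewrite qualifE /= irr_char Dm m1 /=.
Qed.

End DegreeTwo.

(** * Characters inflated from the monomial matrices *)

Section MonomialCharacters.

Variable K : finFieldType.
Let P := (wproj @*^-1 (monomials_group K))%G.
Implicit Types x y : wreath2 {'GL_2[K]}.

Lemma monomial_preP x : (x \in P) = (wproj x \in monomials K).
Proof. by rewrite /P /= in_setI in_setT inE. Qed.

Definition sgn (s : {'GL_2[K]}) : algC := if m00 s == 0 then -1 else 1.

Fact sgn_repr : mx_repr P (fun x => (sgn (wproj x))%:M : 'M_1).
Proof.
split=> [|x y]; first by rewrite /sgn wproj1 ment1 oner_eq0.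
rewrite !monomial_preP => Mx My; rewrite -scalar_mxM /sgn; congr (_%:M).
rewrite wprojM m00M.
case/monomialP: Mx => x1 x2 x3 x4; case/monomialP: My => y1 y2 y3 y4;
  rewrite ?x1 ?x2 ?y1 ?y2 ?mul0r ?mulr0 ?addr0 ?add0r ?mulf_eq0 ?eqxx ?orbT /=.
all: rewrite ?(negPf x3) ?(negPf y3) ?mulr1 ?mul1r ?mulrNN ?mulr1 //.
by rewrite (negPf y4).
Qed.

Section Theta.

Variable F : K -> algC.
Hypotheses (F0 : F 0 = 0) (F1 : F 1 = 1) (FM : {morph F : a b / a * b}).

(** This is the representation induced from the linear character
    diag(a, d) |-> F(a / d) of the diagonal matrices, in a basis where the matrix
    of each monomial matrix is monomial of the same shape: as 0 / 0 = 0 and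
    F 0 = 0, the zero entries stay zero. *)
Definition rho (s : {'GL_2[K]}) : 'M[algC]_2 :=
  mx2 (F (m00 s / m11 s)) (F (m01 s / m10 s))
      (F (m10 s / m01 s)) (F (m11 s / m00 s)).

Fact rho_repr : mx_repr P (fun x => rho (wproj x)).
Proof.
split=> [|x y].
  rewrite /rho wproj1 !ment1 invr0 mulr0 invr1 mulr1 F0 F1.
  by apply/matrixP=> i j; rewrite !mxE; case: (ord2P i) => ->; case: (ord2P j) => ->.
rewrite !monomial_preP => Mx My; rewrite /rho mx2M wprojM !mentM.
case/monomialP: Mx => x1 x2 x3 x4; case/monomialP: My => y1 y2 y3 y4;
  rewrite x1 x2 y1 y2 ?(mul0r, mulr0, addr0, add0r) ?F0 ?(mul0r, mulr0, addr0, add0r).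
all: rewrite -?FM ?mulf_div //.
Qed.

Definition theta : 'CF(P) := cfRepr (MxRepresentation rho_repr).

Lemma thetaE x : x \in P ->
  theta x = F (m00 (wproj x) / m11 (wproj x)) + F (m11 (wproj x) / m00 (wproj x)).
Proof. by move=> Px; rewrite cfunE Px /mxtrace sum2E !mxE. Qed.

Lemma theta_antidiagonal x : x \in P -> antidiag_gl2 (wproj x) -> theta x = 0.
Proof.
by move=> Px /andP[/eqP E1 /eqP E2]; rewrite thetaE // E1 E2 !mul0r F0 addr0.
Qed.

Lemma theta1 : theta 1%g = 2%:R.
Proof. by rewrite cfRepr1. Qed.

(** The commutator of diag(g, 1) and the permutation matrix is diag(g^-1, g), at
    which theta is u + u^-1 for u = F(g^2); this is 2 only if u = 1. *)
Lemma theta_irr g : g != 0 -> F (g * g) != 1 -> theta \in irr P.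
Proof.
move=> nzg Fg.
pose s := gl2 g 0 0 1; pose w : {'GL_2[K]} := gl2 0 1 1 0.
pose c := gl2 g^-1 0 0 g.
have ds : g * 1 - 0 * 0 != 0 by rewrite mul0r subr0 mulr1.
have dw : 0 * 0 - 1 * 1 != 0 :> K by rewrite mul0r sub0r mulr1 oppr_eq0 oner_eq0.
have dc : g^-1 * g - 0 * 0 != 0 by rewrite mul0r subr0 mulVf ?oner_eq0.
have comm : [~ s, w]%g = c.
  apply: (mulgI (w * s)%g); rewrite commgEl conjgE !mulgA mulgK mulgV mul1g.
  apply: ment_inj; rewrite !mentM !(gl2K ds) !(gl2K dw) !(gl2K dc);
  by rewrite ?(mul0r, mulr0, addr0, add0r, mul1r, mulr1) ?mulfV.
have Ps : wlift s \in P.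
  by rewrite monomial_preP wliftK inE /diag_gl2 !(gl2K ds) eqxx.
have Pw : wlift w \in P.
  by rewrite monomial_preP wliftK inE /antidiag_gl2 !(gl2K dw) eqxx orbT.
apply: (degree2_irr (cfRepr_char _) theta1 Ps Pw).
rewrite thetaE ?groupR // -[wproj _]/[~ s, w]%g comm !(gl2K dc) invrK.
have -> : g^-1 / g = (g * g)^-1 by rewrite invfM.
(* u + u^-1 = 2 amounts to (u - 1)^2 = 0 *)
set u := g * g.
have FV : F u * F u^-1 = 1 by rewrite -FM mulfV ?F1 // mulf_neq0.
apply: contra Fg => /eqP E2.
rewrite -subr_eq0 -sqrf_eq0 sqrrB1 -mulr_natl -E2 mulrDl [F u^-1 * _]mulrC FV.
by rewrite opprD addrA addrAC expr2 subrr sub0r addrC subrr.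
Qed.

End Theta.

Definition sgn_char : 'CF(P) := cfRepr (MxRepresentation sgn_repr).

Lemma sgn_charE x : x \in P -> sgn_char x = sgn (wproj x).
Proof. by move=> Px; rewrite cfunE Px mxtrace_scalar. Qed.

Lemma sgn_char_irr : sgn_char \in irr P.
Proof. by apply: lin_char_irr; rewrite qualifE /= cfRepr_char cfRepr1 eqxx. Qed.

Lemma sgn_diagonal x : x \in P -> diag_gl2 (wproj x) -> sgn_char x = 1.
Proof.
move=> Px Dx; rewrite sgn_charE // /sgn ifN //.
by case/andP: Dx (GL2_nz (wproj x)) => /eqP-> _; apply: contraNneq => ->; rewrite !mul0r subr0.
Qed.

Lemma sgn_antidiagonal x : x \in P -> antidiag_gl2 (wproj x) -> sgn_char x = -1.
Proof. by move=> Px /andP[E _]; rewrite sgn_charE // /sgn E. Qed.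

Let Fus := wfusion (monomials_group K).

(** Conjugate elements have images with the same trace and determinant.  Two
    diagonal images then agree up to swapping the entries, and if just one of
    the images is antidiagonal, then the other has trace 0. *)
Lemma eigenvalue_invariant (chi : 'CF(P)) (phi : K -> K -> algC) (k : algC) :
  (forall x, x \in P -> diag_gl2 (wproj x) ->
     chi x = phi (m00 (wproj x)) (m11 (wproj x))) ->
  (forall x, x \in P -> antidiag_gl2 (wproj x) -> chi x = k) ->
  (forall a b, phi a b = phi b a) -> (forall a : K, a != 0 -> phi a (- a) = k) ->
  Defs.invariant Fus chi.
Proof.
move=> chiD chiA phiC phiN x y Px Py /group_fconjP[_ _ /imsetP[g _ Dy]].
have Mx := Px; have My := Py; rewrite !monomial_preP in Mx My.
have Dpy : (wproj g * wproj y = wproj x * wproj g)%g.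
  by rewrite Dy -!wprojM -conjgC.
have [Etr Edet] := GL2_similar (congr1 GLval Dpy).
have diagN (s t : {'GL_2[K]}) : m00 t = 0 -> m11 t = 0 ->
    m00 t + m11 t = m00 s + m11 s -> m11 s = - m00 s.
  by move=> -> -> /eqP; rewrite addr0 eq_sym addrC addr_eq0 => /eqP.
case/monomialP: Mx => x1 x2 x3 x4; case/monomialP: My => y1 y2 y3 y4.
- have dx : diag_gl2 (wproj x) by rewrite /diag_gl2 x1 x2 eqxx.
  have dy : diag_gl2 (wproj y) by rewrite /diag_gl2 y1 y2 eqxx.
  rewrite !chiD //; move: Etr Edet; rewrite x1 y1 !mul0r !subr0.
  move: (m00 (wproj x)) (m11 (wproj x)) (m00 (wproj y)) (m11 (wproj y)).
  move=> a b c d Es Ep.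
  have /eqP : (a - c) * (a - d) = 0.
    have -> : (a - c) * (a - d) = a * a - (c + d) * a + c * d by ring.
    by rewrite Es Ep; ring.
  rewrite mulf_eq0 !subr_eq0 => /orP[] /eqP Ea; move: Es; rewrite Ea.
    by move/addrI->.
  by rewrite [RHS]addrC => /addIr->; rewrite phiC.
- have dx : diag_gl2 (wproj x) by rewrite /diag_gl2 x1 x2 eqxx.
  have dy : antidiag_gl2 (wproj y) by rewrite /antidiag_gl2 y1 y2 eqxx.
  by rewrite chiD // (chiA y) // (diagN _ _ y1 y2 Etr) phiN.
- have dx : antidiag_gl2 (wproj x) by rewrite /antidiag_gl2 x1 x2 eqxx.
  have dy : diag_gl2 (wproj y) by rewrite /diag_gl2 y1 y2 eqxx.
  by rewrite chiA // chiD // (diagN _ _ x1 x2 (esym Etr)) phiN.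
- have dx : antidiag_gl2 (wproj x) by rewrite /antidiag_gl2 x1 x2 eqxx.
  have dy : antidiag_gl2 (wproj y) by rewrite /antidiag_gl2 y1 y2 eqxx.
  by rewrite !chiA.
Qed.

(** The permutation matrix has eigenvalues 1 and -1, hence is conjugate to
    diag(1, -1). *)
Lemma invariant_swap (chi : 'CF(P)) : (-1 : K) != 1 -> Defs.invariant Fus chi ->
  exists x y, [/\ x \in P /\ antidiag_gl2 (wproj x), y \in P, diag_gl2 (wproj y),
    m00 (wproj y) = 1 /\ m11 (wproj y) = -1 & chi x = chi y].
Proof.
move=> charK inv; pose w : {'GL_2[K]} := gl2 0 1 1 0.
pose d : {'GL_2[K]} := gl2 1 0 0 (-1); pose g : {'GL_2[K]} := gl2 1 1 1 (-1).
have dw : 0 * 0 - 1 * 1 != 0 :> K by rewrite mul0r sub0r mulr1 oppr_eq0 oner_eq0.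
have dd : 1 * -1 - 0 * 0 != 0 :> K by rewrite mul0r subr0 mul1r oppr_eq0 oner_eq0.
have dg : 1 * -1 - 1 * 1 != 0 :> K by rewrite !mul1r subr_eq0.
have Aw : antidiag_gl2 w by rewrite /antidiag_gl2 !(gl2K dw) eqxx.
have Dd : diag_gl2 d by rewrite /diag_gl2 !(gl2K dd) eqxx.
have Pw : wlift w \in P by rewrite monomial_preP wliftK inE Aw orbT.
have Pd : wlift d \in P by rewrite monomial_preP wliftK inE Dd.
exists (wlift w), (wlift d); split=> //; first by rewrite wliftK !(gl2K dd).
apply: inv => //; apply/group_fconjP; split=> //.
apply/imsetP; exists (wlift g); first by rewrite inE.
rewrite -wliftJ; congr (wlift _); apply: (mulgI g); rewrite -conjgC.
apply: ment_inj; rewrite !mentM !(gl2K dd) !(gl2K dw) !(gl2K dg);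
by rewrite ?(mul0r, mulr0, addr0, add0r, mul1r, mulr1, mulrNN).
Qed.

End MonomialCharacters.

(** * The relation between indecomposable characters *)

Section Relation.

Variables (K : finFieldType) (f : K -> algC) (g : K).
Hypotheses (charK : (-1 : K) != 1) (g8 : g ^+ 8 = -1).
Hypotheses (f0 : f 0 = 0) (f1 : f 1 = 1) (fM : {morph f : x y / x * y}).
Hypothesis fN1 : f (-1) = -1.

Let P := (wproj @*^-1 (monomials_group K))%G.
Let Fus := wfusion (monomials_group K).

(** The exponent is shifted so that the value at 0 is always 0; thus the
    characters theta_1, theta_2, theta_3 have the indices 0, 1, 2 below. *)
Definition fpow j a := f a ^+ j.+1.

Fact fpow0 j : fpow j 0 = 0. Proof. by rewrite /fpow f0 expr0n. Qed.
Fact fpow1 j : fpow j 1 = 1. Proof. by rewrite /fpow f1 expr1n. Qed.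
Fact fpowM j : {morph fpow j : a b / a * b}.
Proof. by move=> a b; rewrite /fpow fM exprMn. Qed.

Definition theta_pow j : 'CF(P) := theta (fpow0 j) (fpow1 j) (@fpowM j).

Let z := f g.

Lemma z8 : z ^+ 8 = -1.
Proof.
have fX n : f g ^+ n = f (g ^+ n).
  by elim: n => [|n IHn]; rewrite ?expr0 ?f1 // !exprS IHn fM.
by rewrite /z fX g8 fN1.
Qed.

Lemma nz_g : g != 0.
Proof.
by apply: contra_eq_neq g8 => ->; rewrite expr0n eq_sym oppr_eq0 oner_eq0.
Qed.

Lemma oppr1_neq1 : (-1 : algC) != 1.
Proof. by rewrite eq_sym -subr_eq0 opprK (pnatr_eq0 _ 2). Qed.

Lemma z_prim : 16.-primitive_root z.
Proof.
have z16 : z ^+ 16 = 1 by rewrite (exprM z 8 2) z8 sqrrN expr1n.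
have [m prim_m dvd_m] := prim_order_exists (isT : 0 < 16)%N z16.
suff -> : 16%N = m by [].
have ndvd : ~~ (m %| 8)%N by rewrite (prim_order_dvd prim_m) z8 oppr1_neq1.
have : m \in divisors 16 by rewrite -dvdn_divisors.
by rewrite !inE => /or4P[||| /orP[]] /eqP Em; move: ndvd; rewrite Em.
Qed.

Lemma theta_pow_irr j : (j < 3)%N -> theta_pow j \in irr P.
Proof.
move=> lt_j3; apply: (theta_irr _ _ _ nz_g).
rewrite /fpow fM -/z -expr2 -exprM -(prim_order_dvd z_prim).
by case: j lt_j3 => [|[|[]]].
Qed.

Lemma theta_pow_swap j a : a != 0 ->
  fpow j (a / - a) + fpow j (- a / a) = (-1) ^+ j.+1 *+ 2.
Proof.
by move=> nz; rewrite invrN mulrN mulNr mulfV // /fpow fN1 mulr2n.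
Qed.

(** As j + 1 is odd, at diag(a, -a) the sum is 1 - 2, and at antidiagonal
    matrices it is -1 + 0. *)
Lemma sgn_theta_Ind j : (j < 3)%N -> ~~ odd j -> IndF Fus (sgn_char K + theta_pow j).
Proof.
move=> lt_j3 ev_j.
have [/irrP[i Di] /irrP[k Dk]] := (sgn_char_irr K, theta_pow_irr lt_j3).
have sgnN : ~ Defs.invariant Fus (sgn_char K).
  case/(invariant_swap charK)=> x [y [[Px Ax] Py Dy _ /eqP]].
  by rewrite sgn_antidiagonal // sgn_diagonal // (negPf oppr1_neq1).
rewrite Di Dk; apply: Ind_add_irr; rewrite -Di -?Dk //.
pose phi a b := 1 + (fpow j (a / b) + fpow j (b / a)).
apply: (@eigenvalue_invariant _ _ phi (-1)).
- by move=> x Px Dx; rewrite cfunE sgn_diagonal // thetaE.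
- by move=> x Px Ax; rewrite cfunE sgn_antidiagonal // theta_antidiagonal // addr0.
- by move=> a b; rewrite /phi [X in 1 + X]addrC.
- move=> a nz; rewrite /phi theta_pow_swap // exprS -signr_odd (negPf ev_j) mulr1.
  by rewrite mulr2n addrA subrr add0r.
Qed.

(** As j + 1 is odd, at diag(a, -a) the sum is 2 - 2, and at antidiagonal
    matrices it is 0. *)
Lemma theta_theta_Ind j : (j < 3)%N -> ~~ odd j ->
  IndF Fus (theta_pow 1 + theta_pow j).
Proof.
move=> lt_j3 ev_j.
have [/irrP[i Di] /irrP[k Dk]] :=
  (theta_pow_irr (isT : 1 < 3)%N, theta_pow_irr lt_j3).
have N2 : ~ Defs.invariant Fus (theta_pow 1).
  case/(invariant_swap charK)=> x [y [[Px Ax] Py Dy [E1 E2] /eqP]].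
  rewrite theta_antidiagonal // thetaE // E1 E2 theta_pow_swap ?oner_eq0 //.
  by rewrite sqrrN expr1n eq_sym pnatr_eq0.
rewrite Di Dk; apply: Ind_add_irr; rewrite -Di -?Dk //.
pose phi a b := (fpow 1 (a / b) + fpow 1 (b / a)) + (fpow j (a / b) + fpow j (b / a)).
apply: (@eigenvalue_invariant _ _ phi 0).
- by move=> x Px Dx; rewrite cfunE !thetaE.
- by move=> x Px Ax; rewrite cfunE !theta_antidiagonal // addr0.
- by move=> a b; rewrite /phi; congr (_ + _); rewrite addrC.
- move=> a nz; rewrite /phi !theta_pow_swap // sqrrN expr1n.
  by rewrite exprS -signr_odd (negPf ev_j) mulr1 mulNrn subrr.
Qed.

(** At diag(g, 1) the two values are z + z^-1 and z^3 + z^-3, whose difference is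
    (z^4 - 1)(z^2 - 1) / z^3 up to sign. *)
Lemma theta_pow_neq : theta_pow 0 != theta_pow 2.
Proof.
pose s := gl2 g 0 0 1.
have ds : g * 1 - 0 * 0 != 0 by rewrite mul0r subr0 mulr1 nz_g.
have Ps : wlift s \in P.
  by rewrite monomial_preP wliftK inE /diag_gl2 !(gl2K ds) eqxx.
have nz : z != 0.
  by apply: contra_eq_neq z8 => ->; rewrite expr0n eq_sym oppr_eq0 oner_eq0.
have zV : f (1 / g) = z^-1.
  by rewrite -[RHS]mul1r; apply: (canRL (mulfK nz)); rewrite -fM divfK ?nz_g.
have zn1 m : ~~ (16 %| m)%N -> z ^+ m - 1 != 0.
  by rewrite subr_eq0 (prim_order_dvd z_prim).
apply/eqP=> /(congr1 (fun chi : 'CF(P) => chi (wlift s))).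
rewrite !thetaE // wliftK !(gl2K ds) /fpow divr1 zV -/z => E.
have /eqP : (z ^+ 4 - 1) * (z ^+ 2 - 1) = 0.
  have -> : (z ^+ 4 - 1) * (z ^+ 2 - 1)
      = z ^+ 3 * ((z ^+ 3 + z^-1 ^+ 3) - (z ^+ 1 + z^-1 ^+ 1)) by field.
  by rewrite E subrr mulr0.
by rewrite mulf_eq0 !(negPf (zn1 _ _)).
Qed.

Lemma monomial_fusion_card_neq : (IndF Fus #!= (`I_(kF Fus))%classic)%card.
Proof.
apply: (@relation_card_neq _ _ _ _ (sgn_char K + theta_pow 0)
  (theta_pow 1 + theta_pow 2) (sgn_char K + theta_pow 2) (theta_pow 1 + theta_pow 0)).
- exact: sgn_theta_Ind.
- exact: theta_theta_Ind.
- exact: sgn_theta_Ind.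
- exact: theta_theta_Ind.
- by rewrite addrACA [theta_pow 0 + _]addrC addrACA.
- by rewrite (inj_eq (addrI _)) theta_pow_neq.
- rewrite (inj_eq (addIr _)); apply/eqP=> /(congr1 (fun chi : 'CF(P) => chi 1%g)).
  rewrite theta1 sgn_diagonal ?group1 //; last by rewrite /diag_gl2 !ment1 eqxx.
  by apply/eqP; rewrite eq_sym (eqr_nat _ 2 1).
Qed.

End Relation.

(** |GL_2(F_17)| = 17 * 16^2 * 18, with 2-part 2 * 16^2. *)
Lemma monomials_Sylow (K : finFieldType) : #|K| = 17 ->
  2.-Sylow([set: {'GL_2[K]}]) (monomials_group K).
Proof.
move=> cardK; have cardS := card_monomials K; rewrite cardK /= in cardS.
have cardG : #|[set: {'GL_2[K]}]| = ((2 * 16 ^ 2) * (17 * 9))%N.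
  by rewrite card_GL_2 cardK [(2 * _)%N]mulnC mulnACA [(16 ^ 2 * _)%N]mulnC.
rewrite /pHall subsetT -divgS ?subsetT //= cardG cardS mulKn // /pgroup cardS.
by rewrite !pnatM.
Qed.

Theorem mainTheorem4 :
  exists (p : nat) (gT : finGroupType) (P : {group gT}) (F : fusion_system P),
    [/\ prime p, (p.-group P)%g, saturated F p, constrained F
      & (IndF F #!= (`I_(kF F))%classic)%card].
Proof.
have cardK : #|'F_17| = 17 by rewrite card_Fp.
have charK : (-1 : 'F_17) != 1 by [].
(* 3 generates the multiplicative group, so its 8th power is -1 *)
have g8 : (3%:R : 'F_17) ^+ 8 = -1 by apply/eqP.
have [f [f0 f1 fM fN1]] := odd_field_char charK.
have sylS := monomials_Sylow cardK.
exists 2, (wreath2 {'GL_2['F_17]}), (wproj @*^-1 (monomials_group 'F_17))%G.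
exists (wfusion (monomials_group 'F_17)); split; first by [].
- exact: pHall_pgroup (wreath_Sylow sylS).
- exact: wfusion_saturated.
- exact: wfusion_constrained.
- exact: monomial_fusion_card_neq g8 f0 f1 fM fN1.
Qed.
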